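(* Let $k$ be a field of characteristic different from $2$ containing a square root of $-1$, let $n\geq 2$ be an integer, let $x_1,\ldots,x_n$ be independent indeterminates over $k$, put $x_0=x_1\cdots x_n$ and $K=k(x_1,\ldots,x_n)$, and consider the quadratic forms over $K$ \[ q=\langle x_1,\ldots,x_n\rangle,\quad q_0=\langle x_0,x_1,\ldots,x_n\rangle,\quad q'=\langle 1,x_1,\ldots,x_n\rangle,\quad q'_0=\langle 1,x_0,x_1,\ldots,x_n\rangle. \] If $n$ is even, then $q\in I(K)$, $q'_0\in I^2(K)$, and \[ \mathrm{Pf}_1(q)=n\qquad\text{and}\qquad \mathrm{Pf}_2(q'_0)=n-1. \] If $n$ is odd, then $q'\in I(K)$, $q_0\in I^2(K)$, and \[ \mathrm{Pf}_1(q')=n\qquad\text{and}\qquad \mathrm{Pf}_2(q_0)=n-1. \]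
   Context: For a field $F$ of characteristic $\neq 2$, $W(F)$ denotes the Witt ring, $I(F)$ its fundamental ideal (classes of even-dimensional forms) and $I^m(F)$ its $m$-th power; a form is ''in $I^m(F)$'' if its Witt class is. $\langle a_1,\ldots,a_n\rangle$ denotes the diagonal form $\sum a_iX_i^2$. An $m$-fold Pfister form is $\langle\langle a_1,\ldots,a_m\rangle\rangle=\langle 1,a_1\rangle\otimes\cdots\otimes\langle 1,a_m\rangle$ with $a_i\in F^\times$. For $q\in I^m(F)$, the $m$-Pfister number $\mathrm{Pf}_m(q)$ is the least number of terms in an expression of the Witt class of $q$ as a sum of $m$-fold Pfister forms in $W(F)$. *)

(* Defs.v *)
From HB Require Import structures.
From mathcomp Require Import all_boot all_order all_algebra.
From mathcomp Require Import fraction.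
From mathcomp Require Import mpoly.
Set Implicit Arguments. Unset Strict Implicit. Unset Printing Implicit Defensive.
Import Order.TTheory GRing.Theory Num.Theory.
Local Open Scope ring_scope.

Definition ratfun (k : fieldType) (n : nat) : fieldType := {fraction {mpoly k[n]}}.

Definition ratvar (k : fieldType) (n : nat) (i : 'I_n) : ratfun k n :=
  tofrac ('X_i : {mpoly k[n]}).

Definition ratvars (k : fieldType) (n : nat) : seq (ratfun k n) :=
  [seq ratvar k i | i <- enum 'I_n].

Section Forms.
Variable F : fieldType.

(** A diagonal quadratic form <a_1,...,a_r> = sum a_i X_i^2 is given by the
    sequence of its coefficients; it is nondegenerate iff all a_i are nonzero.
    (In characteristic <> 2 every nondegenerate form is diagonalizable.) *)
Definition nondeg (a : seq F) : bool := all (fun x => x != 0) a.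

Definition gram (a : seq F) : 'M[F]_(size a) := diag_mx (\row_(i < size a) a`_i).

Definition isometric (a b : seq F) : Prop :=
  exists P : 'M[F]_(size a, size b),
    [/\ size a = size b, \rank P = size a & P *m gram b *m P^T = gram a].

(** Orthogonal sum of diagonal forms = concatenation; hyperbolic plane <1,-1>. *)
Definition hyp (m : nat) : seq F := flatten (nseq m [:: 1; -1]).

Definition witt_eq (a b : seq F) : Prop :=
  exists m1 m2 : nat, isometric (a ++ hyp m1) (b ++ hyp m2).

Definition tensor (a b : seq F) : seq F := [seq x * y | x <- a, y <- b].

Definition scale (c : F) (a : seq F) : seq F := [seq c * x | x <- a].

Definition pfister (s : seq F) : seq F :=
  foldr (fun a q => tensor [:: 1; a] q) [:: 1] s.

Definition is_pfister (m : nat) (pi : seq F) : Prop :=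
  exists s : seq F, [/\ size s = m, nondeg s & pi = pfister s].

(** q in I^m(F): the Witt class of q lies in the m-th power of the fundamental
    ideal I(F) (classes of even-dimensional forms), i.e. it is a finite sum of
    +/- products of m classes of even-dimensional (nondegenerate) forms. *)
Definition prod_forms (l : seq (seq F)) : seq F := foldr tensor [:: 1] l.

Definition in_Ipow (m : nat) (q : seq F) : Prop :=
  nondeg q /\
  exists terms : seq (bool * seq (seq F)),
    [/\ all (fun t => (size t.2 == m) &&
                      all (fun f => nondeg f && ~~ odd (size f)) t.2) terms
      & witt_eq q
          (flatten [seq scale (if t.1 then -1 else 1) (prod_forms t.2) | t <- terms])].

Definition sum_of_pfisters (m r : nat) (q : seq F) : Prop :=
  exists pis : seq (seq F),
    [/\ size pis = r, (forall pi, pi \in pis -> is_pfister m pi)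
       & witt_eq q (flatten pis)].

Definition pfister_number (m : nat) (q : seq F) (r : nat) : Prop :=
  sum_of_pfisters m r q /\ (forall r', sum_of_pfisters m r' q -> r <= r')%N.
End Forms.

(* Main.v *)
(** Over a field containing a square root of -1, the leading monomial modulo
    squares gives a map [v] from K^* to V = F_2^n with [v(x+y)] in [{v x, v y}]
    whenever [v x <> v y].  By chain equivalence of diagonal forms this makes
    [<a> |-> v a] an additive invariant of W(K) with values in the group ring
    F_2[V], under which an m-fold Pfister form [<<a_1,...,a_m>>] becomes the
    formal sum of all subset sums of [v a_1, ..., v a_m].

    For m = 1 every basis vector [e_i] must be some [v a], so n terms are needed.
    For m = 2, [e_1 + ... + e_n] and the [e_i] form a sum of planes modulo 0; one
    of the planes contains [e_1], and projecting along [e_1] kills it and leaves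
    the same configuration in dimension n - 1, whence n - 1 planes.
    The upper bounds come from <<x_1,x_2>> + <<x_1x_2,x_3>> + ... and from the
    fact that [<c,c>] is hyperbolic. *)

Require Import Defs.
From HB Require Import structures.
From mathcomp Require Import all_boot all_order all_algebra.
From mathcomp Require Import fraction generic_quotient.
From mathcomp Require Import mpoly.
From mathcomp Require Import ring zify.
Import Order.TTheory GRing.Theory Num.Theory.
Local Open Scope ring_scope.
Set Implicit Arguments. Unset Strict Implicit. Unset Printing Implicit Defensive.

(** * Additive invariants of diagonal forms via chain equivalence *)

Section DiagonalInvariant.
Variables (F : fieldType) (A : zmodType) (phi : F -> A).
Hypothesis two_neq0 : (2%:R : F) != 0.
Hypothesis phi_sqr : forall c a, c != 0 -> phi (c ^+ 2 * a) = phi a.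
Hypothesis phi_binary : forall a b, a != 0 -> b != 0 -> a + b != 0 ->
  phi a + phi b = phi (a + b) + phi (a * b * (a + b)).

(** If [y j] and [y l] cancel, a nonzero total forces a third nonzero entry [y t]; if [y t] also
    cancels [y j], then [y l + y t] is minus twice [y j], hence nonzero. The pair selects the plane
    to rotate in the chain equivalence. *)
Lemma exists_anisotropic_pair (I : finType) (y : I -> F) :
  \sum_j y j != 0 -> (1 < #|[set j | (y j != 0)%R]|)%N ->
  exists j l, [/\ j != l, y j != 0, y l != 0 & y j + y l != 0].
Proof.
move=> sum_n0 /card_gt1P[j [l []]]; rewrite !inE => yj yl jl.
have [s0|s_n0] := eqVneq (y j + y l) 0; last by exists j, l.
have [t /and3P[tj tl yt]] : exists t, [&& t != j, t != l & y t != 0].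
  apply/existsP; apply: contraNT sum_n0 => /existsPn H.
  rewrite (bigD1 j) //= (bigD1 l) 1?eq_sym //= addrA s0 add0r big1 // => t.
  case/andP=> tj tl; apply/eqP; have := H t; rewrite tj tl /=.
  by rewrite negbK.
have [u0|u_n0] := eqVneq (y j + y t) 0; last by exists j, t; split; rewrite // eq_sym.
exists l, t; split=> //; first by rewrite eq_sym.
have -> : y l = - y j by apply/eqP; rewrite -addr_eq0 addrC s0.
have -> : y t = - y j by apply/eqP; rewrite -addr_eq0 addrC u0.
by rewrite -opprD oppr_eq0 -mulr2n -mulr_natl mulf_neq0.
Qed.

(* Witt's chain equivalence: rotating two vectors of one orthogonal basis at a
   time, the first vector of the other basis becomes proportional to a single
   basis vector, and its orthogonal complement is handled by induction. *)
Lemma diagonal_invariant m (a b : 'I_m -> F) (P : 'I_m -> 'I_m -> F) :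
  (forall i, a i != 0) -> (forall i, b i != 0) ->
  (forall i l, \sum_j P i j * P l j * b j = (i == l)%:R * a i) ->
  \sum_i phi (a i) = \sum_i phi (b i).
Proof.
elim: m a b P => [|m IHm] a b P a_n0 b_n0 PbP; first by rewrite !big_ord0.
(* Inner induction on the number of nonzero coordinates of the first vector. *)
have [t] := ubnP #|[set j | P ord0 j != 0]|.
elim: t b P b_n0 PbP => // t IHt b P b_n0 PbP; rewrite ltnS => le_t.
pose y j := P ord0 j ^+ 2 * b j.
have yE j : (y j != 0) = (P ord0 j != 0).
  by rewrite /y mulf_eq0 expf_eq0 /= (negPf (b_n0 j)) orbF.
have sum_y : \sum_j y j = a ord0.
  have := PbP ord0 ord0; rewrite eqxx mul1r => <-.
  by apply: eq_bigr => j _; rewrite /y expr2.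
have suppE : [set j | y j != 0] = [set j | P ord0 j != 0].
  by apply/setP => j; rewrite !inE yE.
have [gt1|le1] := ltnP 1 #|[set j | P ord0 j != 0]|.
  have [||j [l [jl yj yl s_n0]]] := @exists_anisotropic_pair _ y.
  - by rewrite sum_y.
  - by rewrite suppE.
  set s := y j + y l in s_n0.
  (* The basis vectors at [j] and [l] are replaced by the component of the first vector in their
     plane, of value [s], and a vector orthogonal to it, of value [b j * b l * s]. [P'] holds the
     new coordinates, so [P' ord0 l = 0]. *)
  pose b' i := if i == j then s else if i == l then b j * b l * s else b i.
  pose P' i k :=
    if k == j then (P i j * P ord0 j * b j + P i l * P ord0 l * b l) / s
    else if k == l then (P i l * P ord0 j - P i j * P ord0 l) / s else P i k.
  have split2 (B : zmodType) (g : 'I_m.+1 -> B) :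
      \sum_k g k = g j + (g l + \sum_(k | (k != j) && (k != l)) g k).
    by rewrite (bigD1 j) //= (bigD1 l) //= eq_sym.
  have lj : (l == j) = false by rewrite eq_sym (negPf jl).
  have b'_n0 i : b' i != 0.
    by rewrite /b'; do 2?case: ifP => _ //; rewrite ?mulf_neq0.
  rewrite (IHt b' P') //.
  - rewrite !split2 /b' !eqxx lj !addrA; congr (_ + _); last first.
      by apply: eq_bigr => k /andP[/negPf-> /negPf->].
    rewrite yE in yj; rewrite yE in yl.
    (* Modulo squares, [b j], [b l] and [b j * b l * s] become [y j], [y l] and [y j * y l * s], the
       terms of [phi_binary]. *)
    rewrite -(phi_sqr (b j) yj) -(phi_sqr (b l) yl) -/(y j) -/(y l).
    rewrite (@phi_binary (y j) (y l)) ?yE //; congr (_ + _).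
    rewrite -/s -(phi_sqr (b j * b l * s) (mulf_neq0 yj yl)).
    by congr phi; rewrite /y; ring.
  - move=> i i'; rewrite -PbP !split2 !addrA; congr (_ + _); last first.
      by apply: eq_bigr => k /andP[/negPf kj /negPf kl]; rewrite /P' /b' kj kl.
    rewrite /P' /b' !eqxx lj.
    by move: s_n0; rewrite /s /y => s_n0; field.
  - apply: leq_trans le_t; apply: proper_card; apply/properP; split.
      apply/subsetP => k; rewrite !inE /P'; have [->|_] := eqVneq k j.
        by rewrite -yE.
      have [->|//] := eqVneq k l.
      by rewrite [X in X - _]mulrC subrr mul0r eqxx.
    exists l; rewrite !inE -?yE // /P' lj eqxx.
    by rewrite [X in X - _]mulrC subrr mul0r eqxx.
(* One coordinate is left; orthogonality to the first vector kills column [j] in the other rows, so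
   that vector splits off. *)
have /existsP[j Pj] : [exists j, P ord0 j != 0].
  apply: contraNT (a_n0 ord0) => /existsPn H; rewrite -sum_y big1 // => j _.
  by apply/eqP; apply: contraNT (H j); rewrite yE.
have P0 k : k != j -> P ord0 k = 0.
  move=> kj; apply/eqP; apply: contraLR le1 => Pk; rewrite -ltnNge.
  by apply/card_gt1P; exists k, j; rewrite !inE.
have Pi0 i : i != ord0 -> P i j = 0.
  move=> i0; have := PbP i ord0; rewrite (negPf i0) mul0r (bigD1 j) //= big1.
    by rewrite addr0 => /eqP; rewrite !mulf_eq0 (negPf Pj) (negPf (b_n0 j)) !orbF => /eqP.
  by move=> k kj; rewrite P0 // mulr0 mul0r.
rewrite big_ord_recl (bigD1_ord j) //=; congr (_ + _).
  rewrite -(phi_sqr (b j) Pj) -/(y j) -sum_y (bigD1 j) //= big1 ?addr0 // => k kj.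
  by rewrite /y P0 // expr0n mul0r.
apply: (IHm _ _ (fun i k => P (lift ord0 i) (lift j k))) => // i l.
have := PbP (lift ord0 i) (lift ord0 l).
rewrite (bigD1_ord j) //= Pi0 ?lift_eqF // mul0r mul0r add0r.
by rewrite (inj_eq lift_inj).
Qed.
End DiagonalInvariant.

(** * Isometry and Witt equivalence of diagonal forms *)

Section Isometry.
Variable F : fieldType.
Implicit Types (a b c d : seq F) (m n : nat).

Lemma nondeg_nth a i : nondeg a -> (i < size a)%N -> a`_i != 0.
Proof. by move=> /allP a_n0 lt_i; apply: a_n0; apply: mem_nth. Qed.

Lemma nondeg_cons x a : nondeg (x :: a) = (x != 0) && nondeg a.
Proof. by []. Qed.

Lemma nondeg_cat a b : nondeg (a ++ b) = nondeg a && nondeg b.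
Proof. exact: all_cat. Qed.

Lemma nondeg_flatten (s : seq (seq F)) : nondeg (flatten s) = all (@nondeg F) s.
Proof. by elim: s => //= a s IHs; rewrite nondeg_cat IHs. Qed.

Lemma nondeg_hyp m : nondeg (hyp F m).
Proof. by elim: m => //= m ->; rewrite oppr_eq0 oner_eq0. Qed.

(* Unlike [gram], the size is a parameter, so that two forms of provably equal
   sizes get Gram matrices of the same type. *)
Definition gramn m a : 'M[F]_m := diag_mx (\row_(i < m) a`_i).

Lemma gramn_unit m a : nondeg a -> size a = m -> gramn m a \in unitmx.
Proof.
move=> a_n0 sz; rewrite unitmxE det_diag unitfE prodf_seq_neq0.
by apply/allP => i _ /=; rewrite mxE nondeg_nth ?sz.
Qed.

Lemma gramn_cat m n a b : size a = m ->
  gramn (m + n) (a ++ b) = block_mx (gramn m a) 0 0 (gramn n b).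
Proof.
move=> sz; apply/matrixP => i j.
rewrite -[i]splitK -[j]splitK; case: (split i) => i'; case: (split j) => j' /=.
- rewrite block_mxEul !mxE /= nth_cat sz ltn_ord.
  by rewrite (inj_eq (@lshift_inj _ _)).
- by rewrite block_mxEur !mxE /= eq_lrshift.
- by rewrite block_mxEdl !mxE /= eq_rlshift.
- rewrite block_mxEdr !mxE /= nth_cat sz ltnNge leq_addr /= addKn.
  by rewrite (inj_eq (@rshift_inj _ _)).
Qed.

(** The full rank of [P] comes from the equation, whose right-hand side is invertible because [a] is
    nondegenerate. *)
Lemma isometricP a b : nondeg a ->
  isometric a b <->
  size a = size b /\ exists P, P *m gramn (size a) b *m P^T = gramn (size a) a.
Proof.
move=> a_n0; have gram_n0 := gramn_unit a_n0 erefl; rewrite /isometric /gram.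
have E m n : m = n ->
    (exists P : 'M[F]_(m, n), P *m gramn n b *m P^T = gramn m a) <->
    exists P, P *m gramn m b *m P^T = gramn m a by move=> ->.
split=> [[P [sz _ PbP]]|[sz]].
  by split=> //; apply/(E _ _ sz); exists P.
move=> /(E _ _ sz)[P PbP]; exists P; split=> //.
apply/eqP; rewrite eqn_leq rank_leq_row /=.
apply: leq_trans (mxrankM_maxl P (gramn (size b) b *m P^T)).
by move: gram_n0; rewrite mulmxA PbP -row_free_unit => /eqP->.
Qed.

Lemma isometric_refl a : nondeg a -> isometric a a.
Proof.
move=> a_n0; apply/(isometricP _ a_n0); split=> //.
by exists 1%:M; rewrite trmx1 mulmx1 mul1mx.
Qed.

Lemma isometric_sym a b : nondeg a -> nondeg b -> isometric a b -> isometric b a.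
Proof.
move=> a_n0 b_n0 /(isometricP _ a_n0)[sz [P PbP]].
have := gramn_unit a_n0 erefl; rewrite -PbP !unitmx_mul => /andP[/andP[Pu _] _];
 apply/(isometricP _ b_n0); split=> //; rewrite -sz.
exists (invmx P).
by rewrite -PbP -!mulmxA -trmx_mul mulVmx // trmx1 mulmx1 mulmxA mulVmx ?mul1mx.
Qed.

Lemma isometric_trans a b c : nondeg a -> nondeg b ->
  isometric a b -> isometric b c -> isometric a c.
Proof.
move=> a_n0 b_n0 /(isometricP _ a_n0)[sab [P PbP]] /(isometricP _ b_n0)[sbc [Q QcQ]].
apply/(isometricP _ a_n0); split; first by rewrite sab.
rewrite -{}sab in Q QcQ; exists (P *m Q).
by rewrite trmx_mul -PbP -QcQ !mulmxA.
Qed.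

Lemma isometric_cat a b c d : nondeg a -> nondeg b ->
  isometric a c -> isometric b d -> isometric (a ++ b) (c ++ d).
Proof.
move=> a_n0 b_n0 /(isometricP _ a_n0)[sac [P PcP]] /(isometricP _ b_n0)[sbd [Q QdQ]].
apply/isometricP; first by rewrite nondeg_cat a_n0.
split; first by rewrite !size_cat sac sbd.
rewrite size_cat; exists (block_mx P 0 0 Q).
rewrite !gramn_cat // tr_block_mx !mulmx_block !trmx0.
by rewrite !(mulmx0, mul0mx, addr0, add0r) PcP QdQ.
Qed.

Lemma isometric_perm a b : nondeg a -> perm_eq a b -> isometric a b.
Proof.
move=> a_n0 ab; apply/(isometricP _ a_n0); split; first exact: perm_size.
have /(perm_iotaP 0)[s s_perm aE] := ab.
have sz_s : size s = size a by rewrite aE size_map.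
have s_uniq : uniq s by rewrite (perm_uniq s_perm) iota_uniq.
have s_lt i : (i < size a)%N -> (nth 0%N s i < size a)%N.
  move=> lt_i; have : nth 0%N s i \in s by rewrite mem_nth ?sz_s.
  by rewrite (perm_mem s_perm) mem_iota (perm_size ab).
exists (\matrix_(i, j) (nat_of_ord j == nth 0%N s i)%:R); apply/matrixP => i l.
rewrite !mxE (bigD1 (Ordinal (s_lt i (ltn_ord i)))) //= big1 => [|j ne_j].
  rewrite addr0 mul_mx_diag !mxE eqxx mul1r nth_uniq ?sz_s //.
  by rewrite mulr_natr /= -(nth_map 0%N 0) ?sz_s // -aE.
rewrite mul_mx_diag !mxE (negPf (_ : nat_of_ord j != _)) ?mul0r //.
Qed.

(** As -1 is a square, <x,x> is isometric to <x,-x>, so each entry contributes one hyperbolic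
    plane. *)
Lemma isometric_dbl c : (2%:R : F) != 0 -> (exists i : F, i ^+ 2 = -1) ->
  nondeg c -> isometric (c ++ c) (hyp F (size c)).
Proof.
move=> two_n0 [i i2]; elim: c => [_|x c IHc xc_n0]; first exact: isometric_refl.
have := xc_n0; rewrite nondeg_cons => /andP[x_n0 c_n0].
have xx_n0 : nondeg [:: x; x] by rewrite /= x_n0.
have cc_n0 : nondeg (c ++ c) by rewrite nondeg_cat c_n0.
have xx_iso : isometric [:: x; x] [:: 1; -1].
  apply/(isometricP _ xx_n0); split=> //=.
  (* [x = ((x+1)/2)^2 - ((x-1)/2)^2], and [i] swaps the two squares. *)
  pose p : seq (seq F) :=
    [:: [:: (x + 1) / 2%:R; (x - 1) / 2%:R];
        [:: i * (x - 1) / 2%:R; i * (x + 1) / 2%:R]].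
  exists (\matrix_(i, j) (nth [::] p i)`_j); apply/matrixP => j l.
  rewrite mul_mx_diag !mxE !big_ord_recl big_ord0 !mxE /=.
  case: j => [[|[|//]] ltj]; case: l => [[|[|//]] ltl]; rewrite /= -?val_eqE /=.
  - by rewrite mulr1n; field.
  - by rewrite mulr0n; field.
  - by rewrite mulr0n; field.
  - by rewrite mulr1n; transitivity (- i ^+ 2 * x); [field | rewrite i2 opprK mul1r].
have dblE : perm_eq ((x :: c) ++ (x :: c)) ([:: x; x] ++ (c ++ c)).
  by apply/permP => p; rewrite /= !count_cat /=; lia.
have xcc_n0 : nondeg ((x :: c) ++ (x :: c)) by rewrite nondeg_cat xc_n0.
have xxcc_n0 : nondeg ([:: x; x] ++ (c ++ c)) by rewrite nondeg_cat xx_n0.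
apply: (isometric_trans xcc_n0 xxcc_n0 (isometric_perm xcc_n0 dblE)).
exact: (isometric_cat xx_n0 cc_n0 xx_iso (IHc c_n0)).
Qed.

(** Doubled forms are hyperbolic, so Witt equivalence follows from comparing multisets of entries;
    the upper bounds rest on such counts. *)
Lemma witt_eq_dbl a b c d : (2%:R : F) != 0 -> (exists i : F, i ^+ 2 = -1) ->
  nondeg (a ++ b ++ c ++ d) -> perm_eq (a ++ (c ++ c)) (b ++ (d ++ d)) ->
  witt_eq a b.
Proof.
move=> two_n0 hi; rewrite !nondeg_cat => /and4P[a_n0 b_n0 c_n0 d_n0] ab.
exists (size c), (size d).
have cc_n0 : nondeg (c ++ c) by rewrite nondeg_cat c_n0.
apply: (@isometric_trans _ (a ++ (c ++ c)));
  rewrite ?nondeg_cat ?a_n0 ?nondeg_hyp ?c_n0 //.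
  apply: isometric_cat; rewrite ?nondeg_hyp //; first exact: isometric_refl.
  by apply: isometric_sym; rewrite ?nondeg_hyp //; apply: isometric_dbl.
apply: (@isometric_trans _ (b ++ (d ++ d)));
  rewrite ?nondeg_cat ?a_n0 ?b_n0 ?c_n0 ?d_n0 //.
  by apply: isometric_perm; rewrite ?nondeg_cat ?a_n0 ?c_n0.
apply: isometric_cat; rewrite ?nondeg_cat ?d_n0 //; first exact: isometric_refl.
exact: isometric_dbl.
Qed.

Section Invariant.
Variables (A : zmodType) (phi : F -> A).
Hypothesis two_neq0 : (2%:R : F) != 0.
Hypothesis phi_sqr : forall x y, x != 0 -> phi (x ^+ 2 * y) = phi y.
Hypothesis phi_binary : forall x y, x != 0 -> y != 0 -> x + y != 0 ->
  phi x + phi y = phi (x + y) + phi (x * y * (x + y)).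
Hypothesis phi_hyp : phi 1 + phi (-1) = 0.

Lemma isometric_sum a b : nondeg a -> nondeg b -> isometric a b ->
  \sum_(x <- a) phi x = \sum_(x <- b) phi x.
Proof.
move=> a_n0 b_n0 /(isometricP _ a_n0)[sz [P PbP]].
rewrite !(big_nth (0 : F)) !big_mkord -sz.
apply: (diagonal_invariant two_neq0 phi_sqr phi_binary (P := P)).
- by move=> i; apply: nondeg_nth.
- by move=> i; apply: nondeg_nth; rewrite -?sz.
move=> i l; move/matrixP/(_ i l): PbP; rewrite mul_mx_diag !mxE mulr_natl => <-.
by apply: eq_bigr => j _; rewrite !mxE mulrAC.
Qed.

(** By [phi_hyp] hyperbolic planes contribute nothing, so the invariant descends to Witt classes. *)
Lemma witt_eq_sum a b : nondeg a -> nondeg b -> witt_eq a b ->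
  \sum_(x <- a) phi x = \sum_(x <- b) phi x.
Proof.
have sum_hyp m : \sum_(x <- hyp F m) phi x = 0.
  by elim: m => [|m IHm]; rewrite ?big_nil //= !big_cons IHm addr0.
move=> a_n0 b_n0 [m1 [m2 /isometric_sum]].
by rewrite !nondeg_cat a_n0 b_n0 !nondeg_hyp !big_cat /= !sum_hyp !addr0 => ->.
Qed.
End Invariant.
End Isometry.

Lemma addF2 (x : 'F_2) : x + x = 0.
Proof. by case: x => [[|[|//]] ?]; apply/val_inj. Qed.

(** * Leading monomials modulo squares *)

Section LeadClass.
Variables (k : fieldType) (n : nat).
Local Notation P := {mpoly k[n]}.
Local Notation K := (ratfun k n).
Local Notation V := ('rV['F_2]_n).

Lemma addV2 (u : V) : u + u = 0.
Proof. by apply/rowP => i; rewrite !mxE addF2. Qed.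

Lemma addVK (u w : V) : u + w + w = u.
Proof. by rewrite -addrA addV2 addr0. Qed.

Definition mlead2 (p : P) : V := \row_i ((mlead p i)%:R : 'F_2).

Lemma mlead2M p q : p != 0 -> q != 0 -> mlead2 (p * q) = mlead2 p + mlead2 q.
Proof. by move=> p0 q0; apply/rowP => i; rewrite !mxE mleadM // mnmDE natrD. Qed.

(** Different classes come from different leading monomials, so the larger one survives in the
    sum. *)
Lemma mlead2D p q : mlead2 p != mlead2 q ->
  mlead2 (p + q) = mlead2 p \/ mlead2 (p + q) = mlead2 q.
Proof.
rewrite /mlead2; case: (ltgtP (mlead p) (mlead q)) => [lt|lt|->]; last by rewrite eqxx.
  by rewrite mleadDr //; right.
by rewrite mleadDl //; left.
Qed.

(** Taken from a chosen, possibly unreduced representative; [vclass_div] shows that the choice does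
    not affect the class. *)
Definition ratnum (x : K) : P := (frac (repr x)).1.
Definition ratden (x : K) : P := (frac (repr x)).2.

Lemma ratden_neq0 (x : K) : ratden x != 0.
Proof. exact: denom_ratioP. Qed.

Lemma ratnum_div_ratden (x : K) : x = tofrac (ratnum x) / tofrac (ratden x).
Proof.
have d0 := ratden_neq0 x.
apply/(canRL (mulfK _)); first by rewrite tofrac_eq0.
rewrite /ratnum /ratden; move: {d0} (denom_ratioP (repr x)).
have {2}-> : x = (\pi_(FracField.type P) (repr x))%qT by rewrite reprK.
case: (repr x) => [[p q] pq0] q0; rewrite /= in q0 *.
unlock FracField.tofrac; rewrite -[LHS]FracField.pi_mul; apply/eqmodP => /=.
by rewrite FracField.equivfE /FracField.mulf !numden_Ratio ?mulf_neq0 ?oner_neq0 //=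
  !mulr1 mulrC.
Qed.

(* The class modulo 2 of the value of [x] under the rank-n valuation given by
   leading monomials; it is junk at [x = 0]. *)
Definition vclass (x : K) : V := mlead2 (ratnum x) + mlead2 (ratden x).

Lemma tofrac_neq0 (p : P) : p != 0 -> tofrac p != 0 :> K.
Proof. by rewrite tofrac_eq0. Qed.

Lemma ratnum_neq0 (x : K) : x != 0 -> ratnum x != 0.
Proof.
by apply: contraNneq => p0; rewrite [x]ratnum_div_ratden p0 tofrac0 mul0r.
Qed.

Lemma vclass_div (p q : P) : p != 0 -> q != 0 ->
  vclass (tofrac p / tofrac q) = mlead2 p + mlead2 q.
Proof.
move=> p0 q0; rewrite /vclass; set x : K := _ / _.
have x0 : x != 0 by rewrite mulf_neq0 ?invr_eq0 ?tofrac_neq0.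
have r0 := ratnum_neq0 x0; have d0 := ratden_neq0 x.
have /eqP := ratnum_div_ratden x; rewrite {1}/x eqr_div ?tofrac_neq0 //.
rewrite -!tofracM tofrac_eq => /eqP/(congr1 mlead2); rewrite !mlead2M // => E.
by rewrite -(addVK (mlead2 p) (mlead2 (ratden x))) E addrAC addVK.
Qed.

Lemma ratfun_div (x : K) : x != 0 ->
  exists p q : P, [/\ p != 0, q != 0 & x = tofrac p / tofrac q].
Proof.
move=> x0; exists (ratnum x), (ratden x); split; last exact: ratnum_div_ratden.
  exact: ratnum_neq0.
exact: ratden_neq0.
Qed.

Lemma vclassM (x y : K) : x != 0 -> y != 0 -> vclass (x * y) = vclass x + vclass y.
Proof.
move=> /ratfun_div[p [q [p0 q0 ->]]] /ratfun_div[r [s [r0 s0 ->]]].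
rewrite mulf_div -!tofracM !vclass_div ?mulf_neq0 // !mlead2M //.
by rewrite addrACA.
Qed.

(** Over a common denominator this is [mlead2D] for the numerators. *)
Lemma vclassD (x y : K) : x != 0 -> y != 0 -> x + y != 0 ->
  vclass x != vclass y -> vclass (x + y) = vclass x \/ vclass (x + y) = vclass y.
Proof.
move=> /ratfun_div[p [q [p0 q0 ->]]] /ratfun_div[r [s [r0 s0 ->]]].
have E1 : tofrac p / tofrac q = tofrac (p * s) / tofrac (q * s) :> K.
  by rewrite !tofracM -mulf_div divff ?mulr1 ?tofrac_neq0.
have E2 : tofrac r / tofrac s = tofrac (q * r) / tofrac (q * s) :> K.
  by rewrite !tofracM -mulf_div divff ?mul1r ?tofrac_neq0.
rewrite {}E1 {}E2 -mulrDl -tofracD => sum0.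
have {}sum0 : p * s + q * r != 0.
  by apply: contraNneq sum0 => ->; rewrite tofrac0 mul0r.
rewrite !vclass_div ?mulf_neq0 // (inj_eq (addIr _)) => /mlead2D[->|->];
  by [left|right].
Qed.

Lemma vclass1 : vclass 1 = 0.
Proof. by rewrite -[1]mulr1 vclassM ?oner_neq0 ?addV2. Qed.

Lemma vclass_sqr (x : K) : x != 0 -> vclass (x ^+ 2) = 0.
Proof. by move=> x0; rewrite expr2 vclassM ?addV2. Qed.

Lemma mvar_neq0 i : 'X_i != 0 :> P.
Proof. by rewrite -msupp_eq0 msuppX. Qed.

Lemma ratvar_neq0 i : ratvar k i != 0 :> K.
Proof. exact: tofrac_neq0 (mvar_neq0 i). Qed.

Lemma vclass_var i : vclass (ratvar k i) = delta_mx 0 i.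
Proof.
rewrite -[ratvar k i]divr1 -tofrac1 vclass_div ?mvar_neq0 ?oner_neq0 //.
apply/rowP => j; rewrite !mxE mleadXm mlead1 mnm1E mnm0E addr0 /=.
by rewrite eq_sym.
Qed.

Lemma vclass_prod (I : Type) (r : seq I) (x : I -> K) :
  (forall i, x i != 0) -> vclass (\prod_(i <- r) x i) = \sum_(i <- r) vclass (x i).
Proof.
move=> x0; elim: r => [|i r IHr]; first by rewrite !big_nil vclass1.
rewrite !big_cons vclassM ?IHr //.
by rewrite prodf_seq_neq0; elim: (r) => //= j s ->; rewrite x0.
Qed.

Section Functional.
Variable f : V -> 'F_2.
Hypothesis two_neq0 : (2%:R : k) != 0.
Hypothesis has_i : exists i : k, i ^+ 2 = -1.

Lemma ratfun_two_neq0 : (2%:R : K) != 0.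
Proof.
rewrite -(rmorph_nat (@FracField.tofrac P)) tofrac_eq0.
by rewrite -(rmorph_nat (@mpolyC n k)) mpolyC_eq0.
Qed.

Lemma ratfun_has_i : exists i : K, i ^+ 2 = -1.
Proof.
case: has_i => i i2; exists (tofrac (i%:MP : P)).
by rewrite -tofracXn -rmorphXn /= i2 rmorphN1 tofracN tofrac1.
Qed.

(** [f] extends linearly to the group ring F_2[V]; letting [f] vary recovers equality there. *)
Lemma witt_eq_vclass (a b : seq K) : nondeg a -> nondeg b -> witt_eq a b ->
  \sum_(x <- a) f (vclass x) = \sum_(x <- b) f (vclass x).
Proof.
have m1 : vclass (-1) = 0.
  have [i i2] := ratfun_has_i; rewrite -i2 vclass_sqr //.
  by apply: contra_eq_neq i2 => ->; rewrite expr0n eq_sym oppr_eq0 oner_neq0.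
apply: (@witt_eq_sum _ _ (fun x => f (vclass x)) ratfun_two_neq0).
- move=> x y x0; have [->|y0] := eqVneq y 0; first by rewrite mulr0.
  by rewrite (vclassM (expf_neq0 _ x0) y0) (vclass_sqr x0) add0r.
- move=> x y x0 y0 xy0; rewrite (vclassM (mulf_neq0 x0 y0) xy0) (vclassM x0 y0).
  (* If the classes agree, both sides vanish in characteristic 2. Otherwise [x + y] takes the class
     of one of [x], [y], and [x * y * (x + y)] that of the other. *)
  have [E|/(vclassD x0 y0 xy0)[->|->]] := eqVneq (vclass x) (vclass y).
  + by rewrite E addV2 add0r !addF2.
  + by rewrite addrAC addV2 add0r.
  + by rewrite addVK addrC.
- by rewrite vclass1 m1 addF2.
Qed.
End Functional.
End LeadClass.

(** * Upper bounds: explicit sums of Pfister forms *)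

Section PfisterSums.
Variable F : fieldType.
Implicit Types (a b s q zs : seq F).

Lemma nondeg_pfister s : nondeg s -> nondeg (pfister s).
Proof.
elim: s => [_|x s IHs]; first by rewrite /= oner_eq0.
rewrite nondeg_cons => /andP[x0 /IHs /allP s0].
apply/allP => z /allpairsP[[u v] [/= uin /s0 v0 ->]]; rewrite mulf_neq0 //.
by move: uin; rewrite !inE => /orP[]/eqP->; rewrite ?oner_eq0.
Qed.

Lemma pfister1E (x : F) : pfister [:: x] = [:: 1; x].
Proof. by rewrite /pfister /tensor /= !mulr1. Qed.

Lemma pfister2E (x y : F) : pfister [:: x; y] = [:: 1; y; x; x * y].
Proof. by rewrite /pfister /tensor /= !mulr1 !mul1r. Qed.

Lemma nondeg_nseq1 m : nondeg (nseq m (1 : F)).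
Proof. by rewrite /nondeg all_nseq oner_eq0 orbT. Qed.

Lemma sum_of_pfistersP m r q : sum_of_pfisters m r q <->
  exists ss : seq (seq F),
    [/\ size ss = r, all (fun s => (size s == m) && nondeg s) ss
      & witt_eq q (flatten [seq pfister s | s <- ss])].
Proof.
split=> [[pis [<- pisP qE]]|[ss [<- /allP ssP qE]]]; last first.
  exists [seq pfister s | s <- ss]; split=> //; first by rewrite size_map.
  by move=> pi /mapP[s /ssP /andP[/eqP sz s0] ->]; exists s.
have [ss ssP pisE] : exists2 ss, all (fun s => (size s == m) && nondeg s) ss
    & pis = [seq pfister s | s <- ss].
  elim: pis pisP {qE} => [|pi pis IHpis] pisP; first by exists [::].
  have [|ss ssP ->] := IHpis; first by move=> t tin; apply: pisP; rewrite inE tin orbT.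
  have [s [sz s0 ->]] := pisP pi (mem_head _ _).
  by exists (s :: ss) => //=; rewrite sz eqxx s0.
by exists ss; split; rewrite // -?pisE // pisE size_map.
Qed.

(** A Pfister form is a product of binary forms <1,x>, so the explicit sums also yield membership in
    I^m. *)
Lemma sum_of_pfisters_in_Ipow m r q :
  nondeg q -> sum_of_pfisters m r q -> in_Ipow m q.
Proof.
move=> q0 /sum_of_pfistersP[ss [_ ssP qE]]; split=> //.
exists [seq (false, [seq [:: 1; x] | x <- s]) | s <- ss]; split.
  apply/allP => _ /mapP[s /(allP ssP) /andP[/eqP sz s0] ->] /=.
  rewrite size_map sz eqxx; apply/allP => _ /mapP[x xin ->] /=.
  by rewrite oner_eq0 (allP s0).
rewrite -map_comp (eq_map (_ : _ =1 @pfister F)) // => s /=.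
by rewrite /prod_forms foldr_map /scale (eq_map (@mul1r F)) map_id.
Qed.

Hypothesis two_neq0 : (2%:R : F) != 0.
Hypothesis has_i : exists i : F, i ^+ 2 = -1.

(** The forms <1,x> add up to [a] and [size a] ones; ones cancel in pairs, leaving one exactly when
    [size a] is odd. *)
Lemma sum_of_1pfisters a : nondeg a ->
  sum_of_pfisters 1 (size a) (nseq (odd (size a)) 1 ++ a).
Proof.
move=> a0; apply/sum_of_pfistersP; exists [seq [:: x] | x <- a]; split.
- by rewrite size_map.
- by apply/allP => _ /mapP[x xin ->]; rewrite /= (allP a0).
apply: (witt_eq_dbl (c := nseq (size a)./2 1) (d := [::])) => //.
  rewrite !nondeg_cat !nondeg_nseq1 a0 nondeg_flatten all_map /= andbT.
  apply/allP => _ /mapP[x xin ->]; apply: nondeg_pfister.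
  by rewrite /= (allP a0).
apply/permP => p; rewrite !count_cat !count_nseq /= addn0.
have -> : count p (flatten [seq pfister s | s <- [seq [:: x] | x <- a]]) =
          (p 1%R * size a + count p a)%N.
  elim: (a) => [|x b IHb]; first by rewrite muln0.
  rewrite !map_cons pfister1E /= IHb; case: (p 1) => /=; lia.
by have := odd_double_half (size a); case: (p 1) => /=; lia.
Qed.

(* [<<y, z_1>> + <<y z_1, z_2>> + <<y z_1 z_2, z_3>> + ...], a telescoping sum. *)
Fixpoint pfister_chain (y : F) (zs : seq F) : seq (seq F) :=
  if zs is z :: zs' then [:: y; z] :: pfister_chain (y * z) zs' else [::].

Lemma size_pfister_chain y zs : size (pfister_chain y zs) = size zs.
Proof. by elim: zs y => //= z zs IHzs y; rewrite IHzs. Qed.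

Lemma nondeg_pfister_chain y zs : nondeg (y :: zs) ->
  all (fun s => (size s == 2) && nondeg s) (pfister_chain y zs).
Proof.
elim: zs y => //= z zs IHzs y /and3P[y0 z0 zs0]; rewrite y0 z0 /=.
by apply: IHzs; rewrite /= mulf_neq0.
Qed.

(** In <<y,z>> = <1,z,y,yz> the entry yz recurs as the first slot of the next form; [d] gathers the
    first slots. The term [2 * p y] covers the empty chain, where the product is [y] itself. *)
Lemma count_pfister_chain y zs : nondeg (y :: zs) ->
  exists2 d, nondeg d & forall p,
    (count p (flatten [seq pfister s | s <- pfister_chain y zs]) + 2 * p y =
     p 1%R * size zs + p (\prod_(x <- y :: zs) x)%R + p y + count p zs + 2 * count p d)%N.
Proof.
elim: zs y => [|z zs IHzs] y; first by exists [::] => // p; rewrite big_seq1 /=; lia.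
rewrite !nondeg_cons => /and3P[y0 z0 zs0].
have [|d d0 dE] := IHzs (y * z); first by rewrite nondeg_cons mulf_neq0.
exists (y :: d) => [|p]; first by rewrite nondeg_cons y0.
have := dE p; rewrite !big_cons mulrA.
by rewrite [pfister_chain y _]/= map_cons pfister2E /=; case: (p 1) => /=; lia.
Qed.

Lemma sum_of_2pfisters (y : F) zs : nondeg (y :: zs) ->
  sum_of_pfisters 2 (size zs)
    (nseq (odd (size zs)) 1 ++ \prod_(x <- y :: zs) x :: y :: zs).
Proof.
move=> yzs0; apply/sum_of_pfistersP; exists (pfister_chain y zs).
have ch0 := nondeg_pfister_chain yzs0.
split=> //; first exact: size_pfister_chain.
have [d d0 dE] := count_pfister_chain yzs0.
(* The doubled [[:: y]] accounts for [2 * p y], and the ones cancel in pairs. *)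
apply: (witt_eq_dbl (c := nseq (size zs)./2 1 ++ d) (d := [:: y])) => //.
  have prod0 : \prod_(x <- y :: zs) x != 0.
    by rewrite prodf_seq_neq0; apply/allP => x /(allP yzs0).
  rewrite !nondeg_cat !nondeg_nseq1 (nondeg_cons (\prod_(x <- y :: zs) x)) prod0 yzs0 d0
    nondeg_flatten all_map.
  have /andP[y0 _] := yzs0; rewrite nondeg_cons y0 /= andbT.
  by apply/allP => s /(allP ch0) /andP[_ s0]; apply: nondeg_pfister.
apply/permP => p; have := dE p; rewrite !count_cat !count_nseq /=.
by have := odd_double_half (size zs); case: (p 1) => /=; lia.
Qed.
End PfisterSums.

(** * Counting planes over F_2 *)

Section PlaneSums.
Variable n : nat.
Local Notation V := ('rV['F_2]_n).
Local Notation e i := (delta_mx 0 i : V).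

Lemma delta_inj : injective (fun i => e i).
Proof.
move=> i j /rowP/(_ i); rewrite !mxE !eqxx /=.
by case: eqVneq => // _ /eqP; rewrite oner_eq0.
Qed.

Lemma delta_neq0 i : e i != 0.
Proof. by apply/eqP => /rowP/(_ i); rewrite !mxE !eqxx => /eqP; rewrite oner_eq0. Qed.

Lemma sum_deltaE (S : {set 'I_n}) j : (\sum_(i in S) e i) 0 j = (j \in S)%:R.
Proof.
rewrite summxE; case: (boolP (j \in S)) => jS.
  rewrite (bigD1 j) //= mxE !eqxx big1 ?addr0 // => i /andP[_ ij].
  by rewrite mxE eq_sym (negPf ij) andbF.
rewrite big1 // => i iS; rewrite mxE eqxx; case: eqVneq => //= ji.
by move: jS; rewrite ji iS.
Qed.

(** Projection along [e i], kept inside [V] so that the induction runs over subsets of the basis. *)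
Definition kill (i : 'I_n) (u : V) : V := \row_j (if j == i then 0 else u 0 j).

Lemma killD i u w : kill i (u + w) = kill i u + kill i w.
Proof. by apply/rowP => j; rewrite !mxE; case: eqP; rewrite ?addr0. Qed.

Lemma kill0 i : kill i 0 = 0.
Proof. by apply/rowP => j; rewrite !mxE if_same. Qed.

Lemma kill_delta i j : kill i (e j) = if j == i then 0 else e j.
Proof.
apply/rowP => l; rewrite !mxE; have [->|ji] := eqVneq j i.
  by rewrite !mxE; case: eqP.
by rewrite !mxE; have [->|//] := eqVneq l i; rewrite [i == j]eq_sym (negPf ji) andbF.
Qed.

Lemma kill_sum i (I : Type) (r : seq I) (P : pred I) (u : I -> V) :
  kill i (\sum_(j <- r | P j) u j) = \sum_(j <- r | P j) kill i (u j).
Proof. exact: (big_morph _ (killD i) (kill0 i)). Qed.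

(* Some plane of the sum contains [e i]; projecting along [e i] collapses this
   plane and leaves a configuration of the same shape for [S :\ i]. *)
Lemma leq_card_planes (S : {set 'I_n}) (s : seq (V * V)) :
  (forall f : V -> 'F_2, f 0 = 0 ->
     \sum_(p <- s) (f p.1 + f p.2 + f (p.1 + p.2)) =
     \sum_(i in S) f (e i) + f (\sum_(i in S) e i)) ->
  (#|S| <= (size s).+1)%N.
Proof.
have [m] := ubnP #|S|; elim: m S s => // m IHm S s ltSm sE.
have [le1|gt1] := leqP #|S| 1; first exact: leq_trans le1 _.
have /card_gt1P[i [j [iS jS ij]]] := gt1.
(* The indicator of [e i] gives 1 on the right, as the total sum has a nonzero coordinate at [j] and
   so differs from [e i]; hence some plane contributes. *)
have [p ps pi] : exists2 p, p \in s & e i \in [:: p.1; p.2; p.1 + p.2].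
  apply/hasP; have := sE (fun u => (u == e i)%:R).
  rewrite eq_sym (negPf (delta_neq0 i)) => /(_ erefl); apply: contra_eqT => /hasPn H.
  rewrite big1_seq => [|p /andP[_ /H]]; last first.
    rewrite !inE !negb_or => /and3P[p1 p2 p12].
    by rewrite ![_ == e i]eq_sym (negPf p1) (negPf p2) (negPf p12) !addr0.
  rewrite (bigD1 i) //= eqxx big1 => [|l /andP[_ li]]; last first.
    by rewrite (inj_eq delta_inj) (negPf li).
  rewrite (negPf (_ : \sum_(l in S) e l != e i)) ?addr0 1?eq_sym ?oner_eq0 //.
  apply/eqP => /rowP/(_ j); rewrite sum_deltaE jS mxE eq_sym (negPf ij) andbF.
  by move/eqP; rewrite eq_sym oner_eq0.
pose s' := [seq (kill i q.1, kill i q.2) | q <- rem p s].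
have szs : size s = (size s').+1.
  by rewrite size_map size_rem // prednK //; case: (s) ps.
rewrite szs (cardsD1 i) iS add1n ltnS; apply: IHm.
  by move: ltSm; rewrite (cardsD1 i) iS add1n ltnS.
move=> f f0; have := sE (f \o kill i); rewrite /= kill0 => /(_ f0).
rewrite (perm_big _ (perm_to_rem ps)) big_cons /= big_map.
(* One vector of the plane maps to 0, so the other two have the same image and cancel. *)
have -> : f (kill i p.1) + f (kill i p.2) + f (kill i (p.1 + p.2)) = 0.
  have ki : kill i (e i) = 0 by rewrite kill_delta eqxx.
  move: pi; rewrite !inE => /or3P[]/eqP E.
  - by rewrite killD -E ki f0 !add0r addF2.
  - by rewrite killD -E ki f0 !addr0 addF2.
  rewrite -E ki f0 addr0; move: ki; rewrite E killD => ki.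
  by rewrite -(addVK (kill i p.1) (kill i p.2)) ki add0r addF2.
under eq_bigr do rewrite killD.
rewrite add0r => ->; rewrite kill_sum !(big_setD1 i iS) /= kill_delta eqxx f0 !add0r.
congr (_ + f _); apply: eq_bigr => l; rewrite !inE => /andP[li _];
  by rewrite kill_delta (negPf li).
Qed.
End PlaneSums.

(** * Lower bounds from leading classes *)

Section LowerBounds.
Variables (k : fieldType) (n : nat).
Local Notation K := (ratfun k n).
Local Notation V := ('rV['F_2]_n).
Hypothesis two_neq0 : (2%:R : k) != 0.
Hypothesis has_i : exists i : k, i ^+ 2 = -1.

Lemma nondeg_ratvars : nondeg (ratvars k n).
Proof. by apply/allP => _ /mapP[i _ ->]; apply: ratvar_neq0. Qed.

Lemma size_ratvars : size (ratvars k n) = n.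
Proof. by rewrite size_map size_enum_ord. Qed.

Lemma sum_vclass_pfisters m r (q : seq K) : nondeg q -> sum_of_pfisters m r q ->
  exists ss : seq (seq K),
    [/\ size ss = r, all (fun s => (size s == m) && nondeg s) ss
      & forall f : V -> 'F_2, \sum_(x <- q) f (vclass x) =
          \sum_(s <- ss) \sum_(x <- pfister s) f (vclass x)].
Proof.
move=> q0 /sum_of_pfistersP[ss [sz ssP qE]]; exists ss; split=> // f.
rewrite (witt_eq_vclass f two_neq0 has_i q0 _ qE) ?big_flatten ?big_map //.
rewrite nondeg_flatten all_map; apply/allP => s /(allP ssP) /andP[_].
exact: nondeg_pfister.
Qed.

Lemma sum_vclass_ratvars (f : V -> 'F_2) :
  \sum_(x <- ratvars k n) f (vclass x) = \sum_i f (delta_mx 0 i).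
Proof. by rewrite big_map big_enum; apply: eq_bigr => i _; rewrite vclass_var. Qed.

(** Entries 1 have class 0, so tests with [f 0 = 0] ignore them and both parities of [n] are treated
    alike. *)
Lemma sum_vclass_nseq1 (f : V -> 'F_2) m (a : seq K) : f 0 = 0 ->
  \sum_(x <- nseq m 1 ++ a) f (vclass x) = \sum_(x <- a) f (vclass x).
Proof.
by move=> f0; elim: m => //= m IHm; rewrite big_cons IHm vclass1 f0 add0r.
Qed.

Lemma leq_sum_of_1pfisters m r :
  sum_of_pfisters 1 r (nseq m 1 ++ ratvars k n) -> (n <= r)%N.
Proof.
move=> /sum_vclass_pfisters[|ss [<- /allP ssP qE]].
  by rewrite nondeg_cat nondeg_nseq1 nondeg_ratvars.
rewrite -(size_map (fun s => vclass s`_0)) -[X in (X <= _)%N](size_enum_ord n).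
rewrite -(size_map (fun i => delta_mx 0 i : V)) uniq_leq_size //.
  by rewrite map_inj_uniq ?enum_uniq //; apply: delta_inj.
(* This indicator sums to 1 over the variables, so some slot must have class [delta_mx 0 i]. *)
move=> _ /mapP[i _ ->]; pose f (u : V) : 'F_2 := (u == delta_mx 0 i)%:R.
have f0 : f 0 = 0 by rewrite /f eq_sym (negPf (delta_neq0 i)).
have := qE f; rewrite sum_vclass_nseq1 // sum_vclass_ratvars.
apply: contra_eqT => i_notin.
rewrite (bigD1 i) //= {1}/f eqxx big1 ?addr0 => [|j ji]; last first.
  by rewrite /f (inj_eq (@delta_inj n)) (negPf ji).
rewrite big1_seq ?oner_eq0 // => s /andP[_ sin].
have /andP[sz s0] := ssP s sin; case: s sz s0 sin => [|x [|//]] // _ _ sin.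
rewrite pfister1E big_cons big_seq1 vclass1 f0 add0r /f.
rewrite (negPf (_ : vclass x != _)) //; apply: contraNneq i_notin => <-.
by apply/mapP; exists [:: x].
Qed.

Lemma leq_sum_of_2pfisters m r :
  sum_of_pfisters 2 r (nseq m 1 ++ \prod_(x <- ratvars k n) x :: ratvars k n) ->
  (n.-1 <= r)%N.
Proof.
have x0_n0 : \prod_(x <- ratvars k n) x != 0.
  by rewrite prodf_seq_neq0; apply/allP => x /(allP nondeg_ratvars).
move=> /sum_vclass_pfisters[|ss [<- /allP ssP qE]].
  by rewrite nondeg_cat nondeg_nseq1 nondeg_cons x0_n0 nondeg_ratvars.
(* The entries of <<x,y>> have as classes 0, the two slot classes and their sum: a possibly
   degenerate plane. *)
pose s := [seq (vclass t`_0, vclass t`_1) | t <- ss].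
rewrite -(size_map (fun t => (vclass t`_0, vclass t`_1)) ss) -/s.
suff : (#|[set: 'I_n]| <= (size s).+1)%N by rewrite cardsT card_ord; lia.
apply: leq_card_planes => f f0; have := qE f.
rewrite sum_vclass_nseq1 // big_cons sum_vclass_ratvars.
rewrite big_map big_enum vclass_prod => [|i]; last exact: ratvar_neq0.
under [X in f X]eq_bigr do rewrite vclass_var.
move=> sumE; rewrite !(eq_bigl _ _ (in_setT (T := 'I_n))) addrC {}sumE.
rewrite big_map !big_seq; apply: eq_bigr => t tin.
have /andP[sz t0] := ssP t tin; case: t sz t0 {tin} => [|x [|y [|//]]] // _.
rewrite !nondeg_cons => /and3P[x0 y0 _]; rewrite pfister2E !big_cons big_nil /=.
by rewrite vclass1 f0 (vclassM x0 y0) add0r addr0 [RHS]addrCA -addrA.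
Qed.
End LowerBounds.

(** * Combining the bounds according to the parity of [n] *)

Theorem theorem2p2 (k : fieldType) (n : nat)
  (hchar : (2%:R : k) != 0) (hi : exists i : k, i ^+ 2 = -1) (hn : (2 <= n)%N) :
  let xs := ratvars k n in
  let x0 := \prod_(x <- xs) x in
  let q   := xs in
  let q0  := x0 :: xs in
  let q'  := 1 :: xs in
  let q'0 := 1 :: x0 :: xs in
  (~~ odd n ->
     [/\ in_Ipow 1 q, in_Ipow 2 q'0, pfister_number 1 q n
       & pfister_number 2 q'0 n.-1]) /\
  (odd n ->
     [/\ in_Ipow 1 q', in_Ipow 2 q0, pfister_number 1 q' n
       & pfister_number 2 q0 n.-1]).
Proof.
move=> xs x0 q q0 q' q'0.
have two_n0 := ratfun_two_neq0 n hchar; have has_i := ratfun_has_i n hi.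
have xs_n0 : nondeg xs := nondeg_ratvars k n.
have sz_xs : size xs = n := size_ratvars k n.
have x0_n0 : x0 != 0 by rewrite prodf_seq_neq0; apply/allP => x /(allP xs_n0).
have up1 : sum_of_pfisters 1 n (nseq (odd n) 1 ++ xs).
  by have := sum_of_1pfisters two_n0 has_i xs_n0; rewrite sz_xs.
have up2 : sum_of_pfisters 2 n.-1 (nseq (odd n.-1) 1 ++ x0 :: xs).
  (* The first variable starts the chain and the other [n.-1] extend it; [hn] excludes the empty
     list. *)
  rewrite /x0; case: (xs) xs_n0 sz_xs => [_ sz|y zs yzs_n0 sz].
    by have := hn; rewrite -[X in (1 < X)%N]sz.
  have := sum_of_2pfisters two_n0 has_i yzs_n0.
  by rewrite (congr1 predn sz : size zs = n.-1).
have low1 m r := @leq_sum_of_1pfisters k n hchar hi m r.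
have low2 m r := @leq_sum_of_2pfisters k n hchar hi m r.
(* Thus the extra entry 1 appears in the 2-fold sum for even [n] and in the 1-fold sum for odd
   [n]. *)
have odd_pred : odd n.-1 = ~~ odd n by case: (n) hn => //= m _; rewrite negbK.
rewrite odd_pred in up2.
split=> odd_n; rewrite ?odd_n ?(negPf odd_n) /= in up1 up2; split.
- by apply: sum_of_pfisters_in_Ipow up1.
- by apply: sum_of_pfisters_in_Ipow up2; rewrite !nondeg_cons oner_eq0 x0_n0.
- by split=> // r; apply: (low1 0%N).
- by split=> // r; apply: (low2 1%N).
- by apply: sum_of_pfisters_in_Ipow up1; rewrite nondeg_cons oner_eq0.
- by apply: sum_of_pfisters_in_Ipow up2; rewrite nondeg_cons x0_n0.
- by split=> // r; apply: (low1 1%N).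
- by split=> // r; apply: (low2 0%N).
Qed.
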